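(* Let $S$ be a finite transformation semigroup on a finite set. Then there is a left-zero subsemigroup $S'\subseteq S$, all of whose elements have minimal rank among the elements of $S$, such that $\mathrm{Gr}(S)=\mathrm{Gr}(S')$.
   Context: Transformations act on the right; the rank of a transformation is the size of its image. A semigroup $T$ is left-zero if $ab=a$ for all $a,b\in T$. For a set $M$ of transformations of a finite set $V$, $\mathrm{Gr}(M)$ is the graph on $V$ in which distinct $v,w$ are adjacent iff there is no $f\in M$ with $vf=wf$. *)

(* Defs.v *)
From HB Require Import structures.
From mathcomp Require Import all_boot.

Set Implicit Arguments.
Unset Strict Implicit.
Unset Printing Implicit Defensive.

Local Open Scope group_scope.

(* The alias keeps the product below (composition) separate from the pointwise
   product that {ffun V -> V} inherits when V carries a multiplication. *)
Definition transf (V : finType) : Type := {ffun V -> V}.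

HB.instance Definition _ (V : finType) := Finite.on (transf V).

(* Transformations act on the right: v (f g) = (v f) g. *)
Definition transf_mul (V : finType) (f g : transf V) : transf V :=
  [ffun v => g (f v)].

Lemma transf_mulA (V : finType) : associative (@transf_mul V).
Proof. by move=> f g h; apply/ffunP => v; rewrite !ffunE. Qed.

HB.instance Definition _ (V : finType) :=
  isSemigroup.Build (transf V) (@transf_mulA V).

Lemma transf_mulE (V : finType) (f g : transf V) (v : V) :
  (f * g) v = g (f v).
Proof. by rewrite ffunE. Qed.

Definition rank (V : finType) (f : transf V) : nat := #|f @: [set: V]|.

(* A semigroup of transformations of V; semigroups are nonempty. *)
Definition is_transf_semigroup (V : finType) (T : {set transf V}) : Prop :=
  T != set0 /\ mulg_closed T.

Definition left_zero_on (G : magmaType) (T : {pred G}) : Prop :=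
  {in T &, forall a b, a * b = a}.

(* The adjacency relation of the graph Gr(M) on the vertex set V. *)
Definition Gr (V : finType) (M : {set transf V}) : rel V :=
  fun v w => (v != w) && ~~ [exists f in M, (f : transf V) v == f w].

(* Main.v *)
Require Import Defs.
From mathcomp Require Import all_boot.

(** Let [A] be the image of an element [e] of minimal rank in [S].  For every
    [f] in [S], minimality of the rank makes [f e] permute [A], so a power of
    [f e] fixes [A] pointwise while still mapping [V] into [A] and identifying
    every pair that [f] identifies.  The elements of [S] that retract [V] onto
    [A] form the required left-zero semigroup. *)

(** Each point of [A] lies on a cycle of [h] of length at most [#|V|]. The factorial is a multiple
    of all these lengths, so one exponent serves every point. *)
Lemma iter_fact_fixed (V : finType) (A : {set V}) (h : V -> V) :
    {in A, forall v, h v \in A} -> {in A &, injective h} ->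
  {in A, forall v, iter #|V|`! h v = v}.
Proof.
move=> hA h_inj v Av.
have /dvdnP[q ->] : order h v %| #|V|`!.
  by apply: dvdn_fact; rewrite order_gt0 /order max_card.
elim: q => [|q IHq] //; rewrite mulSn iterD IHq.
exact: (iter_order_in hA).
Qed.

Lemma mulg_closed_iter (V : finType) (S : {set transf V}) (h : transf V) n :
    mulg_closed S -> h \in S ->
  exists2 g : transf V, g \in S & forall v, g v = iter n.+1 h v.
Proof.
move=> mulS Sh; elim: n => [|n [g Sg gE]]; first by exists h.
by exists (g * h)%g => [|v]; [exact: mulS | rewrite transf_mulE gE].
Qed.

Definition retractions (V : finType) (S : {set transf V}) (A : {set V}) :
    {set transf V} :=
  [set g in S | [forall v, (g : transf V) v \in A]
              & [forall v in A, (g : transf V) v == v]].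

Lemma retractionsP (V : finType) (S : {set transf V}) (A : {set V})
    (g : transf V) :
  reflect [/\ g \in S, forall v, g v \in A & {in A, forall v, g v = v}]
          (g \in retractions V S A).
Proof.
rewrite inE; apply: (iffP and3P) => -[Sg gA gid]; split => //.
- exact/forallP.
- by move=> v Av; exact: (eqP (forall_inP gid v Av)).
- exact/forallP.
- by apply/forall_inP => v Av; rewrite gid.
Qed.

(** The left factor already lands in [A], where the right factor acts as the identity. *)
Lemma left_zero_retractions (V : finType) (S : {set transf V}) (A : {set V}) :
  left_zero_on (retractions V S A).
Proof.
move=> a b /retractionsP[_ aA _] /retractionsP[_ _ bid].
by apply/ffunP => v; rewrite transf_mulE bid.
Qed.

Lemma retraction_of_min_rank (V : finType) (S : {set transf V})
    (e f : transf V) :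
    mulg_closed S -> e \in S -> (forall g, g \in S -> rank e <= rank g) ->
    f \in S ->
  exists2 g, g \in retractions V S (e @: [set: V])
           & forall v w, f v = f w -> g v = g w.
Proof.
move=> mulS Se e_min Sf; set A := e @: [set: V].
set h : transf V := (f * e)%g.
have hA v : h v \in A by rewrite transf_mulE imset_f.
have h_inj : {in A &, injective h}.
  apply/imset_injP; rewrite eqn_leq leq_imset_card /=.
  (* The image of [e * h] lies in [h @: A], so minimality of [rank e] gives [#|A| <= #|h @: A|]. *)
  have := e_min (e * h)%g (mulS _ _ Se (mulS _ _ Sf Se)).
  rewrite /rank -/A; move/leq_trans; apply; apply/subset_leq_card/subsetP.
  by move=> _ /imsetP[v _ ->]; rewrite transf_mulE !imset_f.
have [g Sg gE] := mulg_closed_iter V S h #|V|`!.-1 mulS (mulS _ _ Sf Se).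
rewrite (prednK (fact_gt0 _)) in gE.
exists g => [|v w fvw].
  apply/retractionsP; split=> // v; last first.
    by move=> Av; rewrite gE (iter_fact_fixed V A).
  (* The exponent is positive: the last factor [h] of the power sends everything into [A], and its
     first factor begins with [f], so pairs identified by [f] stay identified. *)
  by rewrite gE -(prednK (fact_gt0 #|V|)) iterS.
by rewrite !gE -(prednK (fact_gt0 #|V|)) !iterSr !transf_mulE fvw.
Qed.

Theorem mainTheorem14 (V : finType) (S : {set transf V})
    (semigroup_S : is_transf_semigroup S) :
  exists S' : {set transf V},
    [/\ is_transf_semigroup S',
        S' \subset S,
        left_zero_on S',
        (forall f, f \in S' -> forall g, g \in S -> rank f <= rank g)
      & Gr S =2 Gr S'].
Proof.
have [/set0Pn[e0 Se0] mulS] := semigroup_S.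
case: (arg_minnP (@rank V) Se0) => e Se e_min.
pose A := e @: [set: V]; pose S' := retractions V S A.
have collapse := retraction_of_min_rank V S e _ mulS Se e_min.
have lzS' : left_zero_on S' by exact: left_zero_retractions.
exists S'; split=> //.
- split; last by move=> a b S'a S'b; rewrite lzS'.
  by have [g S'g _] := collapse e Se; apply/set0Pn; exists g.
- by apply/subsetP => g /retractionsP[].
- move=> f /retractionsP[_ fA _] g /e_min; apply: leq_trans.
  by apply/subset_leq_card/subsetP => _ /imsetP[v _ ->].
move=> v w; rewrite /Gr; congr (_ && ~~ _).
apply/exists_inP/exists_inP => -[f Sf /eqP fvw].
  (* The retraction built from [f] inherits the collapse of [v] and [w]; the converse only uses that
     [S'] lies in [S]. *)
  by have [g S'g gvw] := collapse f Sf; exists g => //; rewrite (gvw v w).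
by exists f; [case/retractionsP: Sf | apply/eqP].
Qed.
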